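(* Let $F,G,H$ be directed weighted graphs such that $V_G\cap V_H=\emptyset$ and $V_G\cup V_H\subseteq V_F$. Then $\langle F,G\cup H\rangle=\langle F,G\rangle+\langle F::G,H\rangle$.
   Context: Graphs. A directed weighted graph is a tuple $G=(V_G,E_G,s_G,t_G,\omega_G)$. Here $V_G$ is a finite set of vertices, $E_G$ is a finite or countably infinite set of edges, $s_G,t_G:E_G\to V_G$ are the source and target maps, and $\omega_G:E_G\to(0,1]$ gives the weights. - A path is a finite sequence of edges $(e_0,\dots,e_n)$ with $s(e_{i+1})=t(e_i)$. Its weight is $\prod_i\omega(e_i)$. It is a cycle if $s(e_0)=t(e_n)$. - A cycle $\pi$ is a $1$-cycle if $\pi=\rho^k$ (the concatenation of $k$ copies of a cycle $\rho$) forces $k=1$. A $1$-circuit is the class of a $1$-cycle under cyclic permutation of its edges; its weight is the weight of any representative. - The union $G\cup H$ has vertex set $V_G\cup V_H$ (ordinary union) and edge set $E_G\sqcup E_H$ (disjoint union), with the inherited source, target and weight maps. The plugging colours $G$-edges $0$ and $H$-edges $1$ (colouring $\delta$). - An alternating path is a path in $G\cup H$ with $\delta(e_i)\neq\delta(e_{i+1})$ for all $i$. An alternating cycle is an alternating path that is a cycle with $\delta(e_n)\ne\delta(e_0)$. $\mathrm{Cycl}(G,H)$ is the set of alternating $1$-circuits. - The reduction $G::H$ has vertex set $V_G\triangle V_H$ (symmetric difference). Its edges are the alternating paths whose source and target lie in $V_G\triangle V_H$, with the path's source, target and weight. - The measurement is $\langle G,H\rangle=\sum_{\pi\in\mathrm{Cycl}(G,H)}-\log(1-\omega(\pi))\in[0,\infty]$,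 with $-\log 0=\infty$. *)

(* Defs.v *)
From HB Require Import structures.
From mathcomp Require Import all_boot all_order all_algebra finmap.
From mathcomp Require Import boolp classical_sets reals ereal esum exp.
Set Implicit Arguments.
Unset Strict Implicit.
Unset Printing Implicit Defensive.
Import Order.TTheory GRing.Theory Num.Theory.
Local Open Scope fset_scope.
Local Open Scope ring_scope.

(* All graphs draw their vertices from a common ambient type V, so that the
   vertex sets of two graphs may be compared, intersected and united.  A
   countType is a finite or countably infinite type. *)
Record graph (R : realType) (V : choiceType) := Graph {
  verts : {fset V};
  edge : countType;
  src : edge -> V;
  tgt : edge -> V;
  wgt : edge -> R;
  src_verts : forall e, src e \in verts;
  tgt_verts : forall e, tgt e \in verts;
  wgt_gt0 : forall e, 0 < wgt e;
  wgt_le1 : forall e, wgt e <= 1 }.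

Section Paths.
Context {R : realType} {V : choiceType}.
Implicit Type G : graph R V.

(* A path is a nonempty sequence of edges.  As in mathcomp's path library, it
   is given by its first edge e and the sequence p of the remaining ones. *)
Definition is_path G (e : edge G) (p : seq (edge G)) : bool :=
  path (fun e1 e2 => src e2 == tgt e1) e p.

Definition path_src G (e : edge G) (p : seq (edge G)) : V := src e.

Definition path_tgt G (e : edge G) (p : seq (edge G)) : V := tgt (last e p).

Definition weight G (p : seq (edge G)) : R := \prod_(e <- p) wgt e.

Definition is_cycle G (c : seq (edge G)) : bool :=
  if c is e :: p then is_path e p && (path_src e p == path_tgt e p) else false.

Definition one_cycle G (c : seq (edge G)) : Prop :=
  is_cycle c /\
  forall (rho : seq (edge G)) (k : nat),
    is_cycle rho -> c = flatten (nseq k rho) -> k = 1%N.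

Definition circuit G (c : seq (edge G)) : set (seq (edge G)) :=
  [set c' | exists k : nat, c' = rot k c]%classic.

(* The weight is invariant under rotation, so the representative that xget
   picks is irrelevant; the default [::] is never reached on a circuit. *)
Definition circuit_weight G (C : set (seq (edge G))) : R :=
  weight (xget [::] C).

Lemma weight_gt0 G (p : seq (edge G)) : 0 < weight p.
Proof. by apply: prodr_gt0 => e _; apply: wgt_gt0. Qed.

Lemma weight_le1 G (p : seq (edge G)) : weight p <= 1.
Proof. by apply: prodr_ile1 => e _; rewrite ltW ?wgt_gt0 ?wgt_le1. Qed.

End Paths.

Section Union.
Context {R : realType} {V : choiceType}.
Variables G H : graph R V.

Let uedge : countType := (edge G + edge H)%type.

Definition union_src (e : uedge) : V :=
  match e with inl a => src a | inr b => src b end.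

Definition union_tgt (e : uedge) : V :=
  match e with inl a => tgt a | inr b => tgt b end.

Definition union_wgt (e : uedge) : R :=
  match e with inl a => wgt a | inr b => wgt b end.

Fact union_src_verts e : union_src e \in verts G `|` verts H.
Proof. by case: e => a; rewrite in_fsetU src_verts ?orbT. Qed.

Fact union_tgt_verts e : union_tgt e \in verts G `|` verts H.
Proof. by case: e => a; rewrite in_fsetU tgt_verts ?orbT. Qed.

Fact union_wgt_gt0 e : 0 < union_wgt e.
Proof. by case: e => a; apply: wgt_gt0. Qed.

Fact union_wgt_le1 e : union_wgt e <= 1.
Proof. by case: e => a; apply: wgt_le1. Qed.

Definition graph_union : graph R V :=
  Graph union_src_verts union_tgt_verts union_wgt_gt0 union_wgt_le1.

(* The colouring of the plugging: false on edges of G, true on edges of H. *)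
Definition colour (e : edge graph_union) : bool :=
  match e with inl _ => false | inr _ => true end.

Definition alt_path (e : edge graph_union) (p : seq (edge graph_union)) : bool :=
  is_path e p && path (fun e1 e2 => colour e1 != colour e2) e p.

Definition alt_cycle (c : seq (edge graph_union)) : bool :=
  if c is e :: p then
    [&& alt_path e p, is_cycle c & colour (last e p) != colour e]
  else false.

Definition Cycl : set (set (seq (edge graph_union))) :=
  [set C | exists c, [/\ alt_cycle c, one_cycle c & C = circuit c]]%classic.

Definition measurement : \bar R :=
  (\esum_(C in Cycl) - lne (1 - (circuit_weight C)%:E))%E.

Definition symdiff_verts : {fset V} :=
  (verts G `\` verts H) `|` (verts H `\` verts G).

Definition is_red_edge
    (ep : edge graph_union * seq (edge graph_union)) : bool :=
  [&& alt_path ep.1 ep.2,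
      path_src ep.1 ep.2 \in symdiff_verts &
      path_tgt ep.1 ep.2 \in symdiff_verts].

Definition red_edge : countType :=
  {ep : edge graph_union * seq (edge graph_union) | is_red_edge ep}.

Definition red_src (x : red_edge) : V := path_src (val x).1 (val x).2.

Definition red_tgt (x : red_edge) : V := path_tgt (val x).1 (val x).2.

Definition red_wgt (x : red_edge) : R := weight ((val x).1 :: (val x).2).

Fact red_src_verts x : red_src x \in symdiff_verts.
Proof. by case/and3P: (valP x). Qed.

Fact red_tgt_verts x : red_tgt x \in symdiff_verts.
Proof. by case/and3P: (valP x). Qed.

Fact red_wgt_gt0 x : 0 < red_wgt x.
Proof. exact: weight_gt0. Qed.

Fact red_wgt_le1 x : red_wgt x <= 1.
Proof. exact: weight_le1. Qed.

Definition reduction : graph R V :=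
  Graph red_src_verts red_tgt_verts red_wgt_gt0 red_wgt_le1.

End Union.

(* Main.v *)
Require Import Defs.
From mathcomp Require Import all_boot all_order all_algebra finmap.
From mathcomp Require Import boolp classical_sets functions reals ereal esum exp.
Set Implicit Arguments.
Unset Strict Implicit.
Unset Printing Implicit Defensive.
Import Order.TTheory GRing.Theory Num.Theory.
Local Open Scope ring_scope.
Local Open Scope classical_set_scope.

(** Forgetting the base point and the ambient graph, an alternating 1-circuit is
a primitive cyclic word. Split the 1-circuits of F and G U H according to
whether they use an edge of H. Those that do not are the 1-circuits of F and G.
In a circuit that does, the edges of H separate maximal F-G alternating
segments; an edge of H is adjacent only to edges of F, and its end points lie in
V_F \ V_G, so every segment is an edge of F::G and the circuit is a cyclic word
over F::G and H. Replacing each edge of F::G by its segment is a code that can be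
decoded after every edge of H, hence it preserves and reflects primitivity and is
injective on cyclic words; it also preserves weights. *)

(** * Words up to rotation, and primitivity *)

Section CyclicWords.
Variable T : Type.
Implicit Types (x y : seq T) (e : rel T).

Definition cyc_class x : set (seq T) := [set c | exists k : nat, c = rot k x].

Definition primitive x :=
  forall (rho : seq T) (k : nat), x = flatten (nseq k rho) -> k = 1%N.

Lemma cyc_classP x y :
  cyc_class x y <-> exists u v, x = u ++ v /\ y = v ++ u.
Proof.
split=> [[k ->]|[u [v [-> ->]]]]; last by exists (size u); rewrite rot_size_cat.
by exists (take k x), (drop k x); rewrite cat_take_drop.
Qed.

Lemma cyc_class_refl x : cyc_class x x.
Proof. by exists 0; rewrite rot0. Qed.

Lemma cyc_class_sym x y : cyc_class x y -> cyc_class y x.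
Proof. by move=> /cyc_classP[u [v [-> ->]]]; apply/cyc_classP; exists v, u. Qed.

Lemma cyc_class_trans x y z : cyc_class x y -> cyc_class y z -> cyc_class x z.
Proof.
move=> [k ->] [m ->]; rewrite rot_rot_add.
by exists (rot_add x k m).
Qed.

Lemma cyc_class_eq x y : cyc_class x y -> cyc_class x = cyc_class y.
Proof.
move=> xy; apply/seteqP; split=> z; last exact: cyc_class_trans xy.
exact: cyc_class_trans (cyc_class_sym xy).
Qed.

Lemma cyc_class_inj x y : cyc_class x = cyc_class y -> cyc_class x y.
Proof. by move=> ->; apply: cyc_class_refl. Qed.

Lemma cyc_class_cycle e x y : cyc_class x y -> cycle e x -> cycle e y.
Proof. by move=> [k ->]; rewrite rot_cycle. Qed.

Lemma primitive_neq0 x : primitive x -> x <> [::].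
Proof. by move=> px x0; have := px [::] 0 x0. Qed.

Lemma flatten_nseqC k (u v : seq T) :
  flatten (nseq k (u ++ v)) ++ u = u ++ flatten (nseq k (v ++ u)).
Proof.
elim: k => [|k IH] /=; first by rewrite cats0.
by rewrite -!catA IH.
Qed.

(** Rotating [(a y)^k] by one letter gives [(y a)^k]; iterate. Keeping the exponent is what
    primitivity needs. *)
Lemma rot_flatten_nseq m k x :
  exists y, rot m (flatten (nseq k x)) = flatten (nseq k y).
Proof.
elim: m => [|m [y IH]]; first by exists x; rewrite rot0.
have [small|big] := leqP (size (flatten (nseq k x))) m.+1.
  by exists x; rewrite rot_oversize.
exists (rot 1 y); rewrite rotS 1?ltnW// IH.
case: k {IH big} => [//|k]; case: y => [|a y]; first by elim: k.
have := flatten_nseqC k.+1 [:: a] y.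
by rewrite /= !rot1_cons -!cats1 => -[<-]; rewrite -catA.
Qed.

Lemma cyc_class_primitive x y : cyc_class x y -> primitive x -> primitive y.
Proof.
move=> /cyc_class_sym[k ->] py rho n yE.
by have [rho' rotE] := rot_flatten_nseq k n rho; apply: (py rho'); rewrite yE.
Qed.

End CyclicWords.

(** * Circuits as classes of primitive cyclic words *)

Section WeightedClasses.
Variables (R : realType) (T : choiceType).
Implicit Types (x y : seq T) (w : T -> R) (C : set (seq T)).

Definition circuits (e : rel T) (Q : pred (seq T)) : set (set (seq T)) :=
  [set C | exists x, [/\ cycle e x, primitive x, Q x & C = cyc_class x]].

Definition log_weight w C : \bar R :=
  (- lne (1 - (\prod_(e <- xget [::] C) w e)%:E))%E.

Lemma xget_cyc_class x : cyc_class x (xget [::] (cyc_class x)).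
Proof. by apply: xgetPex; exists x; apply: cyc_class_refl. Qed.

End WeightedClasses.

(** * Transfer of sums along a code *)

(* A code f maps the letters of X to nonempty words over Y, and D is its
   decoder; D is multiplicative only across a cut, a position that follows a
   letter satisfying g. *)
Section Transfer.
Variables (R : realType) (X Y : choiceType) (rX : rel X) (rY : rel Y).
Variables (wX : X -> R) (wY : Y -> R).
Variables (hd : X -> Y) (tl : X -> seq Y).
Variables (D : seq Y -> seq X) (g : pred Y) (Q : pred (seq Y)).

Let f a := hd a :: tl a.
Let Phi x := flatten (map f x).

Hypothesis f_path : forall a, path rY (hd a) (tl a).
Hypothesis f_rel : forall a b, rX a b -> rY (last (hd a) (tl a)) (hd b).
Hypothesis f_weight : forall a, wX a = (\prod_(y <- f a) wY y)%R.
Hypothesis D_nil : D [::] = [::].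
Hypothesis D_cat :
  forall u y v, g y -> D (rcons u y ++ v) = D (rcons u y) ++ D v.
Hypothesis Q_Phi : forall x, x <> [::] -> cycle rX x -> Q (Phi x).
(** Words matter only up to rotation, so decoding need only invert the code after a rotation that
    brings a cut to the end. *)
Hypothesis D_Phi : forall x, x <> [::] -> cycle rX x ->
  exists x' u y, [/\ cyc_class x x', Phi x' = rcons u y, g y & D (Phi x') = x'].
Hypothesis Phi_surj : forall y, y <> [::] -> cycle rY y -> Q y ->
  exists x, cyc_class y (Phi x) /\ cycle rX x.

Let Phi_cat x y : Phi (x ++ y) = Phi x ++ Phi y.
Proof. by rewrite /Phi map_cat flatten_cat. Qed.

Let Phi_nseq k x : Phi (flatten (nseq k x)) = flatten (nseq k (Phi x)).
Proof. by elim: k => //= k <-; rewrite Phi_cat. Qed.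

Let Phi_path a x : path rX a x -> path rY (last (hd a) (tl a)) (Phi x).
Proof.
elim: x a => //= b x IH a /andP[/f_rel ab /IH bx].
by rewrite ab cat_path f_path.
Qed.

Let last_Phi y0 x a : last y0 (Phi (rcons x a)) = last (hd a) (tl a).
Proof. by rewrite -cats1 Phi_cat last_cat /= cats0. Qed.

Let Phi_cycle x : cycle rX x -> cycle rY (Phi x).
Proof.
case/lastP: x => // x a; rewrite (cycle_path a) (cycle_path (hd a)) last_rcons.
by move=> /Phi_path; rewrite last_Phi.
Qed.

Let Phi_cyc x y : cyc_class x y -> cyc_class (Phi x) (Phi y).
Proof.
move=> /cyc_classP[u [v [-> ->]]]; apply/cyc_classP.
by exists (Phi u), (Phi v); rewrite !Phi_cat.
Qed.

Let D_nseq k u y : g y ->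
  D (flatten (nseq k (rcons u y))) = flatten (nseq k (D (rcons u y))).
Proof. by move=> gy; elim: k => //= k <-; rewrite D_cat. Qed.

(** A root [rho] of a code ending at a cut ends in the same letter, so [D] distributes over its
    copies and gives a root of the rotated source word with the same exponent. *)
Let Phi_primitive x : cycle rX x -> primitive x -> primitive (Phi x).
Proof.
move=> cx px.
have [x' [u [y [xx' Px' gy Dx']]]] := D_Phi (primitive_neq0 px) cx.
apply: (cyc_class_primitive (cyc_class_sym (Phi_cyc xx'))) => rho k rhoE.
apply: (cyc_class_primitive xx' px (rho := D rho)).
rewrite -{1}Dx' rhoE.
case: k rhoE => [|k]; first by rewrite Px'; case: (u).
case/lastP: rho => [|rho z] rhoE.
  by move: rhoE; rewrite Px' (_ : flatten _ = [::]) 1?[LHS]lastI//;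
    [case: (u)|elim: k].
suff -> : z = y by rewrite D_nseq.
have := congr1 (last y) rhoE.
rewrite Px' last_rcons -(addn1 k) nseqD flatten_cat /= cats0.
by rewrite last_cat last_rcons.
Qed.

Let primitive_Phi x : primitive (Phi x) -> primitive x.
Proof. by move=> pP rho k xE; apply: (pP (Phi rho)); rewrite xE Phi_nseq. Qed.

(** Rotate so that both codes end at cuts. If they are [s ++ t] and [t ++ s] with both parts
    nonempty, then [s] and [t] end at cuts too, and decoding gives [D s ++ D t] and [D t ++ D s]. *)
Let Phi_cyc_inj x y : x <> [::] -> y <> [::] -> cycle rX x -> cycle rX y ->
  cyc_class (Phi x) (Phi y) -> cyc_class x y.
Proof.
move=> x0 y0 cx cy Pxy.
have [x' [u [a [xx' Px' ga Dx']]]] := D_Phi x0 cx.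
have [y' [v [b [yy' Py' gb Dy']]]] := D_Phi y0 cy.
apply: (cyc_class_trans xx'); apply: cyc_class_trans (cyc_class_sym yy').
have /cyc_classP[s [t [xE yE]]] : cyc_class (Phi x') (Phi y').
  apply: cyc_class_trans (cyc_class_sym (Phi_cyc xx')) _.
  exact: cyc_class_trans Pxy (Phi_cyc yy').
rewrite -Dx' -Dy' xE yE.
case/lastP: s xE yE => [|s c] xE yE.
  by rewrite cats0; apply: cyc_class_refl.
case/lastP: t xE yE => [|t d] xE yE.
  by rewrite cats0; apply: cyc_class_refl.
have <- : a = d by have := congr1 (last a) xE; rewrite Px' last_cat !last_rcons.
have cb : b = c by have := congr1 (last b) yE; rewrite Py' last_cat !last_rcons.
rewrite !D_cat -?cb//.
by apply/cyc_classP; exists (D (rcons s b)), (D (rcons t a)).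
Qed.

Let prod_Phi x : (\prod_(e <- Phi x) wY e = \prod_(e <- x) wX e)%R.
Proof.
rewrite /Phi big_flatten big_map.
by apply: eq_bigr => a _; rewrite f_weight.
Qed.

Let log_weight_Phi x :
  log_weight wY (cyc_class (Phi x)) = log_weight wX (cyc_class x).
Proof.
(* The representatives picked by [xget] correspond under the code only up to rotation, which the
   product ignores. *)
have Phixget := cyc_class_trans (cyc_class_sym (xget_cyc_class (Phi x)))
  (Phi_cyc (xget_cyc_class x)).
rewrite /log_weight -prod_Phi; congr (- lne (1 - _%:E))%E.
by case: Phixget => k ->; apply: perm_big; rewrite perm_sym perm_rot.
Qed.

(** Coding any representative induces a weight-preserving bijection [F] of circuits, because
    rotations go to rotations. *)
Lemma esum_circuits_code :
  (\esum_(C in circuits rY Q) log_weight wY C =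
   \esum_(C in circuits rX predT) log_weight wX C)%E.
Proof.
pose F C := cyc_class (Phi (xget [::] C)).
have FE x : F (cyc_class x) = cyc_class (Phi x).
  exact/esym/cyc_class_eq/Phi_cyc/xget_cyc_class.
rewrite (@reindex_esum _ _ _ (circuits rX predT) _ F).
  by apply: eq_esum => _ [x [_ _ _ ->]]; rewrite FE log_weight_Phi.
split.
- move=> _ [x [cx px _ ->]] /=; rewrite FE; exists (Phi x); split => //.
  + exact: Phi_cycle.
  + exact: Phi_primitive.
  + exact/Q_Phi/cx/primitive_neq0.
- move=> C C' /set_mem[x [cx px _ ->]] /set_mem[y [cy py _ ->]].
  rewrite !FE => /cyc_class_inj xy; apply/cyc_class_eq/Phi_cyc_inj => //.
    exact: primitive_neq0.
  exact: primitive_neq0.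
- move=> _ [y [cy py Qy ->]] /=.
  have [x [yx cx]] := Phi_surj (primitive_neq0 py) cy Qy.
  exists (cyc_class x); last by rewrite FE; apply/esym/cyc_class_eq.
  exists x; split => //.
  exact/primitive_Phi/cyc_class_primitive/py.
Qed.

End Transfer.

(** * Measurements as sums over primitive cycles *)

Section Measurement.
Variables (R : realType) (V : choiceType).
Implicit Types G H : graph R V.

(** With adjacency and alternation in one relation, both wrap-around conditions become the closing
    step of [cycle]. *)
Definition plug_rel G H : rel (edge (graph_union G H)) :=
  fun e1 e2 => (src e2 == tgt e1) && (colour e1 != colour e2).

Lemma alt_pathE G H (e : edge (graph_union G H)) p :
  alt_path e p = path (@plug_rel G H) e p.
Proof. by rewrite /alt_path /is_path -path_relI; apply: eq_path. Qed.

Lemma alt_cycleE G H (c : seq (edge (graph_union G H))) :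
  c <> [::] -> alt_cycle c = cycle (@plug_rel G H) c.
Proof.
case: c => // e p _; rewrite /= rcons_path -alt_pathE /alt_path.
rewrite /plug_rel /path_src /path_tgt.
by case: (is_path e p) => //=.
Qed.

(* A root of a nonempty cycle is itself a cycle, so primitivity among all words is
   the same as primitivity among cycles. *)
Lemma alt_one_cycleP G H (c : seq (edge (graph_union G H))) :
  alt_cycle c /\ one_cycle c <-> cycle (@plug_rel G H) c /\ primitive c.
Proof.
split=> [[ac [cc pc]]|[cc pc]].
  have c0 : c <> [::] by move: ac; case: (c).
  split=> [|rho [|[//|k]] cE]; [by rewrite -alt_cycleE|by []|].
  (* At least two copies of [rho] remain, and the passage from the first to the second is the
     closing step of [rho]. *)
  apply: (pc _ _ _ cE); move: cc; rewrite cE.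
  case: rho cE => [|e p] /= cE; first by case: c0; rewrite cE; elim: (k).
  rewrite /is_path /path_src /path_tgt cat_path /=.
  by case/andP=> /and3P[-> -> _].
have c0 := primitive_neq0 pc; rewrite -alt_cycleE // in cc.
split=> //; split; first by move: cc; case: (c) => // e p /and3P[].
by move=> rho k _; apply: pc.
Qed.

Lemma CyclE G H : @Cycl R V G H = circuits (@plug_rel G H) predT.
Proof.
apply/seteqP; split=> C [c].
  move=> [ac oc ->]; have [cc pc] := (alt_one_cycleP c).1 (conj ac oc).
  by exists c.
move=> [cc pc _ ->]; have [ac oc] := (alt_one_cycleP c).2 (conj cc pc).
by exists c.
Qed.

Lemma measurementE G H :
  measurement G H =
  \esum_(C in circuits (@plug_rel G H) predT)
    log_weight (@wgt R V (graph_union G H)) C.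
Proof. by rewrite /measurement CyclE. Qed.

Lemma log_weight_ge0 G (C : set (seq (edge G))) :
  (0 <= log_weight (@wgt R V G) C)%E.
Proof.
rewrite /log_weight oppe_ge0 lne_le0 -EFinB lee_fin lerBlDr lerDl.
exact/ltW/weight_gt0.
Qed.

End Measurement.

(** * The plugging of F with G and H, and its circuits that avoid H *)

Section Plugging.
Variables (R : realType) (V : choiceType) (F G H : graph R V).
Hypothesis disjGH : (verts G `&` verts H = fset0)%fset.
Hypothesis subF : (verts G `|` verts H `<=` verts F)%fset.

Let FG := graph_union F G.
Let FGH := graph_union F (graph_union G H).
Let RH := graph_union (reduction F G) H.

Let isH (e : edge FGH) : bool := if e is inr (inr _) then true else false.

Let emb (e : edge FG) : edge FGH :=
  match e with inl a => inl a | inr b => inr (inl b) end.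

Let unemb (e : edge FGH) : option (edge FG) :=
  match e with
  | inl a => Some (inl a) | inr (inl b) => Some (inr b) | inr (inr _) => None
  end.

Let embK : pcancel emb unemb.
Proof. by case. Qed.

Let isH_emb e : isH (emb e) = false.
Proof. by case: e. Qed.

Let emb_rel e1 e2 :
  plug_rel (emb e1 : edge FGH) (emb e2) = plug_rel (e1 : edge FG) e2.
Proof. by case: e1 e2 => ? [?|?]. Qed.

Let emb_path e p :
  path (@plug_rel _ _ F (graph_union G H)) (emb e) (map emb p) =
  path (@plug_rel _ _ F G) e p.
Proof. by rewrite path_map; apply: eq_path => ? ?; apply: emb_rel. Qed.

Let emb_wgt e : wgt (emb e) = wgt e.
Proof. by case: e. Qed.

Let has_isH_cyc x y : cyc_class x y -> has isH x = has isH y.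
Proof. by case=> k ->; rewrite has_rot. Qed.

Let unemb_map y : ~~ has isH y -> y = map emb (pmap unemb y).
Proof. by elim: y => //= -[a|[a|a]] y IH //= /IH {1}->. Qed.

(** Each edge is coded by one letter, so every position is a cut; without edges of [H], [pmap unemb]
    drops nothing. *)
Lemma esum_circuits_noH :
  \esum_(C in circuits (@plug_rel _ _ F (graph_union G H))
                       (fun x => ~~ has isH x)) log_weight (@wgt R V FGH) C =
  measurement F G.
Proof.
have PhiE x : flatten [seq [:: emb a] | a <- x] = map emb x.
  exact: flatten_map1.
rewrite measurementE.
apply: (@esum_circuits_code _ _ _ _ _ _ _ emb (fun=> [::]) (pmap unemb) predT).
- by [].
- by move=> a b; rewrite /= emb_rel.
- by move=> a; rewrite big_seq1 emb_wgt.
- by [].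
- by move=> u y v _; rewrite pmap_cat.
- by move=> x _ _; rewrite PhiE has_map -all_predC; apply/allP => e _ /=;
    rewrite isH_emb.
- move=> x x0 _; case/lastP: x x0 => // x a _.
  exists (rcons x a), (map emb x), (emb a); rewrite PhiE map_rcons; split=> //.
    exact: cyc_class_refl.
  by rewrite -map_rcons (map_pK embK).
- move=> y _ cy /unemb_map yE; exists (pmap unemb y); rewrite PhiE -yE.
  split; first exact: cyc_class_refl.
  move: cy; rewrite yE cycle_map (map_pK embK); congr is_true.
  by apply: eq_cycle => ? ?; apply: emb_rel.
Qed.

(** * Circuits through H as words over the reduction and H *)

Let head_edge (a : edge RH) : edge FGH :=
  match a with inl r => emb (val r).1 | inr h => inr (inr h) end.

Let tail_edges (a : edge RH) : seq (edge FGH) :=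
  match a with inl r => map emb (val r).2 | inr _ => [::] end.

Let expand (x : seq (edge RH)) :=
  flatten [seq head_edge a :: tail_edges a | a <- x].

(** The empty list returned when [insub] fails is a dummy value: it makes decoding total, so that
    [decode_cat] holds for arbitrary words. *)
Let contract (acc : seq (edge FG)) : seq (edge RH) :=
  if acc is e :: p then
    if insub (e, p) is Some r then [:: inl (r : red_edge F G)] else [::]
  else [::].

(* acc holds the maximal F-G segment currently being read. *)
Let decode := fix decode (acc : seq (edge FG)) (y : seq (edge FGH)) :=
  match y with
  | [::] => contract acc
  | inl a :: y' => decode (rcons acc (inl a)) y'
  | inr (inl b) :: y' => decode (rcons acc (inr b)) y'
  | inr (inr h) :: y' => contract acc ++ (inr h : edge RH) :: decode [::] y'
  end.

Let decode_emb acc l y : decode acc (map emb l ++ y) = decode (acc ++ l) y.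
Proof.
elim: l acc => [|[a|b] l IH] acc /=; first by rewrite cats0.
  by rewrite IH cat_rcons.
by rewrite IH cat_rcons.
Qed.

(** An edge of [H] flushes the accumulator, so the rest is read from the initial state. *)
Let decode_cat acc u y v : isH y ->
  decode acc (rcons u y ++ v) = decode acc (rcons u y) ++ decode [::] v.
Proof.
move=> Hy; elim: u acc => [|[a|[b|h]] u IH] acc //=.
  by case: y Hy => [//|[//|h]] _ /=; rewrite -catA.
by rewrite IH -catA.
Qed.

Let symdiffE v : (v \in symdiff_verts F G) = (v \in verts F) && (v \notin verts G).
Proof.
rewrite /symdiff_verts in_fsetU !in_fsetD; have /fsubsetP/(_ v) := subF.
by rewrite in_fsetU; case: (v \in verts F); case: (v \in verts G) => // /(_ isT).
Qed.

Let H_symdiff v : v \in verts H -> v \in symdiff_verts F G.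
Proof.
move=> vH; rewrite symdiffE (fsubsetP subF) ?in_fsetU ?vH ?orbT//=.
apply/negP => vG; have : v \in (verts G `&` verts H)%fset by rewrite in_fsetI vG.
by rewrite disjGH in_fset0.
Qed.

(** An edge of [G] here would put the source in [verts G]. With [red_last], this makes the colours
    at both ends of a segment agree with the colour of the reduction edge in its plugging with
    [H]. *)
Let red_head (r : red_edge F G) : colour (val r).1 = false.
Proof.
have /and3P[_ + _] := valP r; rewrite symdiffE => /andP[_].
by rewrite /path_src; case: (val r).1 => // b /negP[]; apply: src_verts.
Qed.

Let red_last (r : red_edge F G) : colour (last (val r).1 (val r).2) = false.
Proof.
have /and3P[_ _] := valP r; rewrite symdiffE => /andP[_].
by rewrite /path_tgt; case: (last _ _) => // b /negP[]; apply: tgt_verts.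
Qed.

Let colour_emb (e : edge FG) : colour (emb e : edge FGH) = colour e.
Proof. by case: e. Qed.

Let src_emb e : src (emb e) = src e.
Proof. by case: e. Qed.

Let tgt_emb e : tgt (emb e) = tgt e.
Proof. by case: e. Qed.

Let head_edge_colour a : colour (head_edge a) = colour (a : edge RH).
Proof. by case: a => //= r; rewrite colour_emb red_head. Qed.

Let last_edge_colour a :
  colour (last (head_edge a) (tail_edges a)) = colour (a : edge RH).
Proof. by case: a => //= r; rewrite last_map colour_emb red_last. Qed.

Let head_edge_src a : src (head_edge a) = src a.
Proof. by case: a => // r; apply: src_emb. Qed.

Let last_edge_tgt a : tgt (last (head_edge a) (tail_edges a)) = tgt a.
Proof. by case: a => // r; rewrite [last _ _]last_map; apply: tgt_emb. Qed.

Let code_path a :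
  path (@plug_rel _ _ F (graph_union G H)) (head_edge a) (tail_edges a).
Proof.
by case: a => //= r; have /and3P[+ _ _] := valP r; rewrite emb_path alt_pathE.
Qed.

Let code_rel a b : plug_rel (a : edge RH) b ->
  plug_rel (last (head_edge a) (tail_edges a)) (head_edge b).
Proof.
by rewrite /plug_rel last_edge_colour head_edge_colour head_edge_src last_edge_tgt.
Qed.

Let code_wgt a :
  wgt a = (\prod_(y <- head_edge a :: tail_edges a) wgt y)%R.
Proof.
case: a => [r|h]; last by rewrite big_seq1.
rewrite -[_ :: _]/(map emb ((val r).1 :: (val r).2)) big_map.
by apply: eq_bigr => e _; rewrite emb_wgt.
Qed.

Let contract_red (r : red_edge F G) :
  contract ((val r).1 :: (val r).2) = [:: inl r].
Proof. by rewrite /contract -surjective_pairing valK. Qed.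

(** The induction carries the decoder state left by [a]: its pending segment if [a] is a reduction
    edge, nothing if it is an edge of [H]. *)
Let decode_expand a x : path (@plug_rel _ _ (reduction F G) H) a x ->
  decode (if a is inl r then (val r).1 :: (val r).2 else [::]) (expand x) =
  (if a is inl r then [:: a] else [::]) ++ x.
Proof.
elim: x a => [|b x IH] [r|h].
- rewrite -[LHS]/(contract ((val r).1 :: (val r).2)).
  by rewrite contract_red.
- by [].
(* Alternation forbids two consecutive reduction edges, whose segments would merge. *)
- case: b => [?|h] /andP[+ hx]; first by rewrite /plug_rel /= andbF.
  move=> _; rewrite -[LHS]/(contract _ ++ inr h :: decode [::] (expand x)).
  by rewrite contract_red (IH _ hx).
- case: b => [r|?] /andP[+ rx]; last by rewrite /plug_rel /= andbF.
  move=> _; rewrite -[LHS]/(decode [::]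
    (map emb ((val r).1 :: (val r).2) ++ expand x)).
  by rewrite decode_emb (IH _ rx).
Qed.

Let last_code_H y0 x h : last y0 (expand x) = inr (inr h) -> x <> [::] ->
  last (inr h) x = inr h :> edge RH.
Proof.
case/lastP: x => // x a; rewrite /expand map_rcons flatten_rcons last_cat last_rcons.
by case: a => [r|h'] /=; [rewrite last_map; case: (last _ _)|case=> ->].
Qed.

(** The word [y] is read from left to right with [acc] as pending segment; ending in an edge of [H]
    ensures that none is left pending. *)
Let expand_surj h acc y :
  path (@plug_rel _ _ F (graph_union G H)) (inr (inr h)) (map emb acc ++ y) ->
  isH (last (inr (inr h)) (map emb acc ++ y)) ->
  exists x, expand x = map emb acc ++ y /\
            path (@plug_rel _ _ (reduction F G) H) (inr h) x.
Proof.
elim: y h acc => [|c y IH] h acc.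
  case: acc => [|e p]; first by exists [::].
  by rewrite cats0 /= last_map isH_emb.
have IHemb e : c = emb e ->
    path (@plug_rel _ _ F (graph_union G H)) (inr (inr h))
      (map emb acc ++ c :: y) ->
    isH (last (inr (inr h)) (map emb acc ++ c :: y)) ->
    exists x, expand x = map emb acc ++ c :: y /\
            path (@plug_rel _ _ (reduction F G) H) (inr h) x.
  by move=> ->; have := IH h (rcons acc e); rewrite map_rcons cat_rcons.
case: c IHemb => [a /(_ (inl a) erefl)//|[b /(_ (inr b) erefl)//|h' _]].
case: acc => [|e p]; first by rewrite /= /plug_rel /= andbF.
rewrite /= cat_path last_cat emb_path /= last_map.
case/and4P=> /andP[]; rewrite src_emb => eh _ ep /andP[]; rewrite tgt_emb.
move=> h'e _ yp yH.
have [x [xE xp]] := IH h' [::] yp yH.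
(* The segment runs between the edges [h] and [h'] of [H], so its end points lie in [verts H]. *)
have red : is_red_edge (e, p).
  apply/and3P; split; first by rewrite alt_pathE.
    by rewrite /path_src (eqP eh); apply/H_symdiff/tgt_verts.
  by rewrite /path_tgt -(eqP h'e); apply/H_symdiff/src_verts.
exists (inl (Sub (e, p) red : red_edge F G) :: inr h' :: x).
split; first by rewrite /expand /= -/(expand x) xE.
by rewrite /= xp /plug_rel /= eh h'e.
Qed.

(** A leading edge of [H] is rotated to the end; after a leading reduction edge, wrap-around
    alternation forces the last letter into [H]. *)
Let rot_last_H x : x <> [::] -> cycle (@plug_rel _ _ (reduction F G) H) x ->
  exists x' h, cyc_class x (rcons x' (inr h)).
Proof.
case: x => [[]//|a x] _; case: a => [r|h]; last first.
  by move=> _; exists x, h, 1; rewrite rot1_cons.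
rewrite /= rcons_path => /andP[_ /andP[_]].
case/lastP: x => [//|x a]; rewrite last_rcons.
case: a => [//|h] _; exists (inl r :: x), h.
exact: cyc_class_refl.
Qed.

Let has_isH_expand x : has (@colour _ _ (reduction F G) H) x -> has isH (expand x).
Proof.
elim: x => //= a x IH /orP[|/IH xH].
  by case: a => // h _; rewrite /expand.
by rewrite /expand /= has_cat -/(expand x) xH !orbT.
Qed.

Let expand_rcons_H x h : expand (rcons x (inr h)) = rcons (expand x) (inr (inr h)).
Proof. by rewrite /expand map_rcons flatten_rcons cats1. Qed.

Lemma esum_circuits_H :
  \esum_(C in circuits (@plug_rel _ _ F (graph_union G H)) (has isH))
     log_weight (@wgt R V FGH) C = measurement (reduction F G) H.
Proof.
rewrite measurementE.
apply: (@esum_circuits_code _ _ _ _ _ _ _ head_edge tail_edges (decode [::]) isH).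
- exact: code_path.
- exact: code_rel.
- exact: code_wgt.
- by [].
- by move=> u y v; apply: decode_cat.
- move=> x x0 cx; have [x' [h [k xE]]] := rot_last_H x0 cx.
  by apply: has_isH_expand; rewrite -(has_rot k) -xE has_rcons.
- move=> x x0 cx; have [x' [h xx']] := rot_last_H x0 cx.
  exists (rcons x' (inr h)), (expand x'), (inr (inr h)).
  rewrite -/(expand _) expand_rcons_H; split=> //; rewrite -expand_rcons_H.
  have := cyc_class_cycle xx' cx; rewrite (cycle_path (inr h)) last_rcons.
  exact: decode_expand.
(* Cutting the cycle after its first edge of [H] makes that edge both the last letter and the
   predecessor of the first, so [expand_surj] applies with an empty accumulator. *)
- move=> y _ + /split_find yH; case: {y} yH => c u v cH _ cy.
  have {cH} [h hE] : exists h, c = inr (inr h).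
    by case: c cH {cy} => [|[|h]] //; exists h.
  subst c.
  have yy' : cyc_class (rcons u (inr (inr h)) ++ v) (v ++ rcons u (inr (inr h))).
    by apply/cyc_classP; exists (rcons u (inr (inr h))), v.
  have := cyc_class_cycle yy' cy.
  rewrite (cycle_path (inr (inr h))) last_cat last_rcons => py.
  have [|x [xE px]] := expand_surj (acc := [::]) py.
    by rewrite /= last_cat last_rcons.
  rewrite -/(expand _).
  exists x; rewrite -/(expand _) xE; split=> //.
  rewrite (cycle_path (inr h)) (last_code_H (y0 := inr (inr h)) (h := h)) //.
    by rewrite xE /= last_cat last_rcons.
  by move=> x0; move: xE; rewrite x0; case: (v); case: (u).
Qed.

Lemma measurement_union_split :
  measurement F (graph_union G H) =
  (measurement F G + measurement (reduction F G) H)%E.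
Proof.
rewrite -esum_circuits_noH -esum_circuits_H [LHS]measurementE.
(* Using [H] is stated through some representative; [has_isH_cyc] makes the choice irrelevant. The
   part that uses [H] comes first, hence the swap below. *)
rewrite (esumID [set C | exists2 x, C x & has isH x]); last first.
  by move=> C _; apply: log_weight_ge0.
rewrite addeC; congr (_ + _)%E; congr (esum _ _); apply/seteqP; split=> C.
- case=> -[x [cx px _ ->]] xH; exists x; split=> //.
  by apply/negP => xH'; apply: xH; exists x => //; apply: cyc_class_refl.
- case=> x [cx px xH ->]; split; first by exists x.
  by case=> x' /= /has_isH_cyc <-; apply/negP.
- by case=> -[x [cx px _ ->]] [x' /= /has_isH_cyc xx']; rewrite -xx'; exists x.
- case=> x [cx px xH ->]; split; first by exists x.
  by exists x => //; apply: cyc_class_refl.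
Qed.

End Plugging.

Theorem mainTheorem2 (R : realType) (V : choiceType) (F G H : graph R V)
    (disjGH : (verts G `&` verts H = fset0)%fset)
    (subF : (verts G `|` verts H `<=` verts F)%fset) :
  measurement F (graph_union G H) =
    (measurement F G + measurement (reduction F G) H)%E.
Proof. exact: measurement_union_split. Qed.
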